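(* Suppose that $X,Y$ are separable real sequence spaces with 1-unconditional bases $\{e_i\}_{i=1}^d$ and $\{f_i\}_{i=1}^d$, respectively, and suppose that all surjective isometries of one of the spaces $X$ or $Y$ onto itself are elementary. Suppose that $T:X\to Y$ is a surjective isometry. Then there exist a set $A\subset\{1,\dots,d\}$ and a one-to-one map $\sigma:A\to\sigma(A)\subset\{1,\dots,d\}$ such that for every $i\in A$ $$T(e_i)=\varepsilon_i f_{\sigma(i)},$$ where $\varepsilon_i=\pm1$. The complementary sets $B_X=\{1,\dots,d\}\setminus A$ and $B_Y=\{1,\dots,d\}\setminus\sigma(A)$ split into families of disjoint pairs $\mathcal{P}_X\subset 2^{B_X}$, $\mathcal{P}_Y\subset 2^{B_Y}$ so that there exists a one-to-one map $\tau$ from $\mathcal{P}_X$ onto $\mathcal{P}_Y$ and if $\tau(i,j)=(k,l)$ then $$T(e_i)=\frac{\delta_i}{\|f_k+f_l\|}(f_k+\varepsilon_i f_l),\qquad T(e_j)=\frac{\delta_i}{\|f_k+f_l\|}(f_k-\varepsilon_i f_l),$$ where $\delta_i,\varepsilon_i=\pm1$. Moreover: (a) all pairs $(i,j)\in\mathcal{P}_X$ and $(k,l)\in\mathcal{P}_Y$ are interchangeable in $X$ or $Y$, respectively; (b) if all isometries of $Y$ (respectively, $X$) onto itself are elementary then the set $A$ (respectively, $\sigma(A)$) depends only on the spaces $X,Y$ and not on the isometry $T$.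
   Context: All spaces are real and isometries are linear. A sequence space is a Banach space with a 1-unconditional basis $\{e_i\}_{i=1}^d$ ($d\le\infty$; if $d=\infty$, $\{1,\dots,d\}$ means $\mathbb{N}$): a (Schauder) basis such that $\|\sum_i\varepsilon_i a_ie_i\|=\|\sum_i a_ie_i\|$ for all $\sum_i a_ie_i$ in the space and all signs $\varepsilon_i=\pm1$. Elements $x=\sum_i x_ie_i$ are identified with their coordinate sequences $(x_i)$. An operator $T:X\to Y$ between two sequence spaces with 1-unconditional bases $\{e_i\}_{i=1}^d$ and $\{f_i\}_{i=1}^d$, respectively ($d\le\infty$), is called elementary if $T(e_i)=a_if_{\sigma(i)}$ for some $a_i\in\mathbb{R}$ and a permutation $\sigma$ of $\{1,\dots,d\}$. A pair of indices $k,l$ is interchangeable in $X$ if for any $x,z\in X$, the conditions $|x_k|=|z_l|$, $|x_l|=|z_k|$ and $|x_i|=|z_i|$ for all $i\ne k,l$ imply that $\|x\|=\|z\|$.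
   Formalization: Both bases are assumed normalized, ‖e_i‖ = ‖f_i‖ = 1 for all i; without this the claim T(e_i) = ±f_σ(i) fails, e.g. X = Y = ℝ, e_1 = 1, f_1 = 2, T = id. *)

(* Defs.v *)
From HB Require Import structures.
From mathcomp Require Import all_boot all_order all_algebra.
From mathcomp Require Import all_classical all_reals all_analysis.

Set Implicit Arguments.
Unset Strict Implicit.
Unset Printing Implicit Defensive.

Import Order.TTheory GRing.Theory Num.Theory.
Import numFieldNormedType.Exports.
Local Open Scope classical_set_scope.
Local Open Scope ring_scope.

(* A dimension d <= oo is an [option nat], with [None] standing for oo; the
   index set {1, ..., d} is represented, zero-based, by {k | k < d}. *)
Definition below (d : option nat) (k : nat) : bool :=
  if d is Some n then (k < n)%N else true.

Definition idx (d : option nat) : Type := {k : nat | below d k}.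

Definition separable (T : topologicalType) : Prop :=
  exists2 S : set T, countable S & dense S.

Section SequenceSpace.
Context (R : realType) (d : option nat) (X : completeNormedModType R).
Implicit Types (e : idx d -> X) (a : idx d -> R).

(* The k-th term of the series \sum_i a_i e_i; it is 0 when k >= d, so that for
   d < oo the partial sums are eventually equal to the finite sum. *)
Definition expansion_term e a (k : nat) : X :=
  oapp (fun i : {k : nat | below d k} => a i *: e i) 0 (insub k).

Definition expansion e a (x : X) : Prop :=
  series (expansion_term e a) @ \oo --> x.

Definition schauder_basis e : Prop :=
  forall x : X, exists! a : idx d -> R, expansion e a x.

Definition unconditional_basis1 e : Prop :=
  schauder_basis e /\
  forall a (x : X) (s : idx d -> bool), expansion e a x ->
    exists2 y : X, expansion e (fun i => (-1) ^+ s i * a i) y & `|y| = `|x|.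

Definition normalized e : Prop := forall i, `|e i| = 1.

Definition interchangeable e (k l : idx d) : Prop :=
  forall (x z : X) (a b : idx d -> R), expansion e a x -> expansion e b z ->
    `|a k| = `|b l| -> `|a l| = `|b k| ->
    (forall i, i <> k -> i <> l -> `|a i| = `|b i|) ->
    `|x| = `|z|.

End SequenceSpace.

Definition surjective_isometry (R : realType) (X Y : completeNormedModType R)
    (T : {linear X -> Y}) : Prop :=
  (forall x, `|T x| = `|x|) /\ range T = setT.

Definition elementary (R : realType) (d : option nat)
    (X Y : completeNormedModType R) (e : idx d -> X) (f : idx d -> Y)
    (T : {linear X -> Y}) : Prop :=
  exists (a : idx d -> R) (sigma : idx d -> idx d),
    bijective sigma /\ forall i, T (e i) = a i *: f (sigma i).

Definition isometries_elementary (R : realType) (d : option nat)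
    (X : completeNormedModType R) (e : idx d -> X) : Prop :=
  forall T : {linear X -> X}, surjective_isometry T -> elementary e e T.

Definition pair_partition (I : Type) (B : set I) (P : set (set I)) : Prop :=
  partition P id B /\
  forall p, P p -> exists i j : I, i <> j /\ p = [set i; j].

(* Pairs are unordered. In the last clause the labelling of {i, j} is
   arbitrary, whereas that of its image {k, l} is chosen: exchanging k and l
   changes the relative sign of the two formulas when both share the sign
   (-1) ^+ delta. *)
Definition decomposition (R : realType) (d : option nat)
    (X Y : completeNormedModType R) (e : idx d -> X) (f : idx d -> Y)
    (T : {linear X -> Y}) (A : set (idx d)) (sigma : idx d -> idx d)
    (PX PY : set (set (idx d))) (tau : set (idx d) -> set (idx d)) : Prop :=
  [/\ set_inj A sigma /\
      forall i, A i -> exists eps : bool, T (e i) = (-1) ^+ eps *: f (sigma i),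
      pair_partition (~` A) PX,
      pair_partition (~` (sigma @` A)) PY,
      set_bij PX PY tau
    & forall i j, i <> j -> PX [set i; j] ->
        exists k l, [/\ k <> l, tau [set i; j] = [set k; l] &
          exists delta eps : bool,
            T (e i) = ((-1) ^+ delta / `|f k + f l|)
                        *: (f k + (-1) ^+ eps *: f l) /\
            T (e j) = ((-1) ^+ delta / `|f k + f l|)
                        *: (f k - (-1) ^+ eps *: f l)]].

(* Main.v *)
(* Say all isometries of Y are elementary. Conjugating by T the reflection of X
   that negates the i-th coordinate gives an isometry U of Y for which id - U
   has rank one with range spanned by T e_i. As U permutes the f_k up to sign,
   some nonzero f_k - U f_k equals 2 f_k or f_k +- f_l, so T e_i is a multiple of
   f_k or of f_k +- f_l. In the second case biorthogonality forces exactly one further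
   T e_j to lie in span (f_k, f_l), and it is a multiple of f_k -+ f_l; the
   conjugate of the j-th reflection exchanges f_k and f_l up to sign. This
   description is invariant under T |-> T^-1, which settles the case where all
   isometries of X are elementary. For (b), T' T^-1 (resp. T^-1 T') is
   elementary, so T and T' send the same e_i to signed basis vectors (resp. hit
   the same f_k up to sign). *)
Require Import Defs.
From HB Require Import structures.
From mathcomp Require Import all_boot all_order all_algebra.
From mathcomp Require Import all_classical all_reals all_analysis.
From mathcomp Require Import ring lra.

Set Implicit Arguments.
Unset Strict Implicit.
Unset Printing Implicit Defensive.

Import Order.TTheory GRing.Theory Num.Theory.
Import numFieldNormedType.Exports.
Local Open Scope classical_set_scope.
Local Open Scope ring_scope.

(** * Coordinate functionals and reflections of a 1-unconditional basis *)

Section Coordinates.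
Context (R : realType) (d : option nat) (X : completeNormedModType R).
Variable e : idx d -> X.
Implicit Types (a b : idx d -> R) (x y : X) (i j : idx d).

Lemma expansion_lin a b c x y : expansion e a x -> expansion e b y ->
  expansion e (fun i => c * a i + b i) (c *: x + y).
Proof.
rewrite /expansion => ax bY.
have -> : series (expansion_term e (fun i => c * a i + b i)) =
    (fun n => c *: series (expansion_term e a) n + series (expansion_term e b) n).
  apply/funext => n; rewrite /series /= scaler_sumr -big_split /=.
  apply: eq_bigr => k _; rewrite /expansion_term.
  by case: insub => [i|] /=; rewrite ?scaler0 ?addr0 // scalerDl scalerA.
by apply: cvgD => //; apply: cvgZl_tmp.
Qed.

Lemma expansion_basis i : expansion e (fun j => (i == j)%:R) (e i).
Proof.
apply: cvg_near_cst; exists (val i).+1 => // n /= lt_in.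
rewrite /series /= (bigD1_seq (val i)) ?mem_index_iota ?iota_uniq //=.
rewrite /expansion_term valK /= eqxx scale1r big1 ?addr0 // => k.
case: insubP => [j _ <- /=|//]; rewrite (inj_eq val_inj) eq_sym => /negbTE ->.
by rewrite scale0r.
Qed.

Lemma expansion0 : expansion e (fun=> 0) 0.
Proof.
apply: cvg_near_cst; apply: nearW => n; rewrite /series /= big1 // => k _.
by rewrite /expansion_term; case: insub => //= i; rewrite scale0r.
Qed.

Lemma expansion_inj a x y : expansion e a x -> expansion e a y -> x = y.
Proof. exact: cvg_unique. Qed.

(** The zero default is never reached once [e] is a basis, by [coordP]. *)
Definition coord x : idx d -> R := xget (fun=> 0) [set a | expansion e a x].

Context (ube : unconditional_basis1 e).

Lemma coordP x : expansion e (coord x) x.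
Proof.
have [a [ax _]] := ube.1 x.
by rewrite /coord; case: xgetP => [b -> //|/(_ a)].
Qed.

Lemma coord_unique a x : expansion e a x -> coord x = a.
Proof.
move=> ax; have [b [_ bP]] := ube.1 x.
by rewrite -(bP _ ax) -(bP _ (@coordP x)).
Qed.

Lemma coord_linear i : linear (fun x => coord x i : R^o).
Proof.
move=> c x y.
by rewrite (coord_unique (expansion_lin (c := c) (@coordP x) (@coordP y))).
Qed.

Lemma coordD x y i : coord (x + y) i = coord x i + coord y i.
Proof. by have := coord_linear i 1 x y; rewrite !scale1r. Qed.

Lemma coordZ c x i : coord (c *: x) i = c * coord x i.
Proof.
have /= := coord_linear i c x 0; rewrite addr0 => ->.
by rewrite (coord_unique expansion0) addr0.
Qed.

Lemma coordB x y i : coord (x - y) i = coord x i - coord y i.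
Proof. by rewrite -scaleN1r coordD coordZ mulN1r. Qed.

Lemma coord_basis i j : coord (e i) j = (i == j)%:R.
Proof. by rewrite (coord_unique (@expansion_basis i)). Qed.

Lemma coord0 i : coord 0 i = 0.
Proof. by rewrite (coord_unique expansion0). Qed.

Lemma coord_eq0 x : (forall i, coord x i = 0) -> x = 0.
Proof.
move=> x0; have := @coordP x; rewrite (_ : coord x = fun=> 0); last exact/funext.
by move/expansion_inj; apply; exact: expansion0.
Qed.

Lemma coord_inj x y : coord x =1 coord y -> x = y.
Proof.
by move=> xy; apply/subr0_eq/coord_eq0 => i; rewrite coordB xy subrr.
Qed.

(** Equal moduli differ by a sign, so flipping the coordinates of [y] that disagree with those of
    [x] produces [x] itself. *)
Lemma norm_coord x y : (forall i, `|coord x i| = `|coord y i|) -> `|x| = `|y|.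
Proof.
move=> xy; pose s i := coord x i != coord y i.
have [z zP <-] := ube.2 _ _ s (@coordP y).
congr `|_|; apply: (expansion_inj (@coordP x)); move: zP; congr expansion.
apply/funext => i; rewrite /s; case: eqVneq => [->|]; first by rewrite mul1r.
by have /eqP := xy i; rewrite eqr_norm2 => /orP[/eqP->|/eqP->]; rewrite ?eqxx ?mulN1r.
Qed.

Definition reflection i x : X := x - (2 * coord x i) *: e i.

Lemma reflection_linear i : linear (reflection i).
Proof.
move=> c x y; apply: coord_inj => j.
by rewrite /reflection !(coordB, coordD, coordZ) coord_basis; ring.
Qed.

Lemma norm_reflection i x : `|reflection i x| = `|x|.
Proof.
apply: norm_coord => j; rewrite coordB coordZ coord_basis.
case: eqVneq => [<-|_]; last by rewrite mulr0 subr0.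
by rewrite -normrN mulr1n; congr `|_|; ring.
Qed.

Lemma reflectionK i : involutive (reflection i).
Proof.
move=> x; apply: coord_inj => j.
rewrite /reflection !(coordB, coordD, coordZ) !coord_basis eqxx mulr1n.
by ring.
Qed.

Context (ne : normalized e).

(** [x] minus its reflection is [(2 * coord x i) *: e i], and both have the norm of [x]. *)
Lemma coord_le_norm x i : `|coord x i| <= `|x|.
Proof.
have : `|(2 * coord x i) *: e i| <= `|x| + `|x|.
  rewrite -{2}(norm_reflection i x) -normrN.
  have -> : - ((2 * coord x i) *: e i) = reflection i x - x.
    by rewrite /reflection addrAC subrr add0r.
  rewrite [leRHS]addrC; exact: ler_normB.
by rewrite normrZ ne mulr1 normrM gtr0_norm //; lra.
Qed.

(** Such a functional vanishes on the partial sums of every expansion, and boundedness carries this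
    to the limit. *)
Lemma functional_eq0 (phi : X -> R) :
    (forall c x y, phi (c *: x + y) = c * phi x + phi y) ->
    (exists C, forall x, `|phi x| <= C * `|x|) ->
    (forall i, phi (e i) = 0) -> phi =1 cst 0.
Proof.
move=> phiL [C phiC] phi0 x.
have p0 : phi 0 = 0 by have := phiL (-1) 0 0; rewrite scaleN1r oppr0 addr0; lra.
have phiS n : phi (series (expansion_term e (coord x)) n) = 0.
  rewrite /series /=; elim/big_ind: _ => // [u v u0 v0|k _].
    by have := phiL 1 u v; rewrite scale1r u0 v0 => ->; ring.
  rewrite /expansion_term; case: insub => //= i.
  by have := phiL (coord x i) (e i) 0; rewrite addr0 phi0 p0 => ->; ring.
(* [C] may be zero or negative; [|C| + 1] is a bound by which [eps] can be divided. *)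
have C1 : 0 < `|C| + 1 by rewrite ltr_pwDr.
apply/normr0_eq0/eqP; rewrite eq_le normr_ge0 andbT; apply/ler_addgt0Pr => eps eps0.
rewrite add0r.
have /cvgrPdist_le /(_ (eps / (`|C| + 1))) := @coordP x.
rewrite divr_gt0 // => /(_ isT) [N _ /(_ N (leqnn N))] /=.
set s := series _ _ => le_s.
have -> : phi x = phi (x - s).
  have := phiL (-1) s x; rewrite scaleN1r addrC => ->.
  by rewrite phiS mulr0 add0r.
apply: (le_trans (phiC _)).
apply: (@le_trans _ _ ((`|C| + 1) * `|x - s|)).
  by apply: ler_wpM2r => //; rewrite (le_trans (ler_norm C)) // lerDl.
by rewrite mulrC -ler_pdivlMr.
Qed.

End Coordinates.

Lemma norm1_sign (R : realDomainType) (a : R) :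
  `|a| = 1 -> exists s : bool, a = (-1) ^+ s.
Proof.
move=> a1; exists (a < 0); move: a1; case: ltrP => a0.
  by rewrite ltr0_norm // expr1 => <-; rewrite opprK.
by rewrite ger0_norm.
Qed.

(** * Surjective isometries and their inverses *)

Section InversePair.
Context (R : realType) (X Y : completeNormedModType R).

Definition inverse_isometries (T : {linear X -> Y}) (S : {linear Y -> X}) :=
  [/\ forall x, `|T x| = `|x|, cancel T S & cancel S T].

Lemma inverse_isometriesP (T : {linear X -> Y}) :
  surjective_isometry T -> exists S, inverse_isometries T S.
Proof.
move=> [isoT surT].
have TK : injective T.
  move=> x y Txy; apply/eqP; rewrite -subr_eq0 -normr_eq0 -isoT linearB.
  by rewrite Txy subrr normr0.
pose S y := xget 0 [set x | T x = y].
have SK : cancel S T.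
  move=> y; rewrite /S; case: xgetP => [x //|/=].
  by have [x _ <-] : range T y by [rewrite surT]; move/(_ x).
have Slin : linear S by move=> c y z; apply: TK; rewrite linearP !SK.
pose S' : {linear Y -> X} := HB.pack S (GRing.isLinear.Build R Y X *:%R S Slin).
by exists S'; split=> // x; apply: TK; rewrite SK.
Qed.

End InversePair.

Lemma inverse_isometries_sym (R : realType) (X Y : completeNormedModType R)
  (T : {linear X -> Y}) (S : {linear Y -> X}) :
  inverse_isometries T S -> inverse_isometries S T.
Proof. by case=> isoT TK SK; split=> // y; rewrite -isoT SK. Qed.

(** * The two shapes of an image, and their symmetry under inversion *)

Section Pairings.
Context (R : realType) (d : option nat) (X Y : completeNormedModType R).
Variables (e : idx d -> X) (f : idx d -> Y).

Definition matched (T : X -> Y) (i k : idx d) : Prop :=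
  exists s : bool, T (e i) = (-1) ^+ s *: f k.

(** The scalar [c] and the second sign [t] are left free, so that the relation survives exchanging
    [i] with [j], [k] with [l], and [T] with its inverse; [paired_formulas] recovers the normalized
    form. *)
Definition paired (T : X -> Y) (i j k l : idx d) : Prop :=
  [/\ i != j, k != l & exists (c : R) (s t : bool),
    [/\ c != 0, T (e i) = c *: (f k + (-1) ^+ s *: f l)
      & T (e j) = ((-1) ^+ t * c) *: (f k - (-1) ^+ s *: f l)]].

Definition covered (T : X -> Y) : Prop :=
  (forall i, (exists k, matched T i k) \/ exists j k l, paired T i j k l) /\
  (forall k, (exists i, matched T i k) \/ exists i j l, paired T i j k l).

(** Factoring [(-1) ^+ s] out of both images puts [f l] first; the difference then changes sign,
    which flips [t]. *)
Lemma pairedCr T i j k l : paired T i j k l -> paired T i j l k.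
Proof.
case=> ij kl [c [s [t [c0 Ti Tj]]]]; split=> //; first by rewrite eq_sym.
exists ((-1) ^+ s * c), s, (~~ t); split.
- by rewrite mulf_neq0 ?signr_eq0.
- by rewrite Ti !scalerDr !scalerA addrC mulrAC -expr2 sqrr_sign mul1r mulrC.
rewrite Tj !scalerBr !scalerA addrC -[- (_ *: f l)]scaleNr -[- (_ *: f k)]scaleNr.
congr (_ *: _ + _ *: _);
  by case: s {Ti Tj}; case: t => /=; rewrite ?expr0 ?expr1; ring.
Qed.

Lemma pairedCl T i j k l : paired T i j k l -> paired T j i k l.
Proof.
case=> ij kl [c [s [t [c0 Ti Tj]]]]; split=> //; first by rewrite eq_sym.
exists ((-1) ^+ t * c), (~~ s), t; split.
- by rewrite mulf_neq0 ?signr_eq0.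
- by rewrite Tj signrN scaleNr.
by rewrite Ti signrN scaleNr opprK mulrA -expr2 sqrr_sign mul1r.
Qed.

End Pairings.

Section Symmetry.
Context (R : realType) (d : option nat) (X Y : completeNormedModType R).
Variables (e : idx d -> X) (f : idx d -> Y).
Variables (T : {linear X -> Y}) (S : {linear Y -> X}).
Hypothesis TSinv : inverse_isometries T S.

Lemma matched_sym i k : matched e f T i k -> matched f e S k i.
Proof.
case: TSinv => _ TK _ [s Ti]; exists s.
by rewrite -[e i]TK Ti linearZ scalerA -expr2 sqrr_sign scale1r.
Qed.

(** Inverting the two-by-two system gives the scalar [(2 * c)^-1] and exchanges the roles of [s] and
    [t]. *)
Lemma paired_sym i j k l : paired e f T i j k l -> paired f e S k l i j.
Proof.
case: TSinv => _ TK _ [ij kl [c [s [t [c0 Ti Tj]]]]]; split=> //.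
have ei : e i = c *: S (f k) + (c * (-1) ^+ s) *: S (f l).
  by rewrite -[e i]TK Ti linearZ linearD linearZ /= scalerDr scalerA.
have ej : e j = ((-1) ^+ t * c) *: S (f k) - ((-1) ^+ t * c * (-1) ^+ s) *: S (f l).
  by rewrite -[e j]TK Tj linearZ linearB linearZ /= scalerBr scalerA.
exists (2 * c)^-1, t, s; split; first by rewrite invr_neq0 // mulf_neq0.
  rewrite ei ej; apply/esym.
  rewrite !(scalerDr, scalerBr, scalerA, scalerN) addrACA -scalerDl -scalerBl.
  rewrite -[RHS]addr0 -[X in _ = X + _]scale1r; congr (_ *: _ + _).
    by case: t {ej Tj}; rewrite /= ?expr0 ?expr1; field.
  apply/eqP; rewrite scaler_eq0; apply/orP; left; apply/eqP.
  by case: t {ej Tj}; rewrite /= ?expr0 ?expr1; field.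
rewrite ei ej; apply/esym.
rewrite !(scalerDr, scalerBr, scalerA, scalerN, opprD, opprK) addrACA -scalerBl -scalerDl.
rewrite -[RHS]add0r -[X in _ = _ + X]scale1r; congr (_ + _ *: _).
  apply/eqP; rewrite scaler_eq0; apply/orP; left; apply/eqP.
  by case: t {ej Tj}; rewrite /= ?expr0 ?expr1; field.
by case: s {ej ei Ti Tj}; case: t; rewrite /= ?expr0 ?expr1; field.
Qed.

End Symmetry.

Lemma covered_sym (R : realType) (d : option nat) (X Y : completeNormedModType R)
  (e : idx d -> X) (f : idx d -> Y) (T : {linear X -> Y}) (S : {linear Y -> X}) :
  inverse_isometries T S -> covered e f T -> covered f e S.
Proof.
move=> TS [covX covY]; split=> [k|i].
  have [[i]|[i [j [l]]]] := covY k; first by move/(matched_sym TS); left; exists i.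
  by move/(paired_sym TS); right; exists l, i, j.
have [[k]|[j [k [l]]]] := covX i; first by move/(matched_sym TS); left; exists k.
by move/(paired_sym TS); right; exists k, l, j.
Qed.

(** * Images of basis vectors when the isometries of the target are elementary *)

Section ElementaryTarget.
Context (R : realType) (d : option nat) (X Y : completeNormedModType R).
Variables (e : idx d -> X) (f : idx d -> Y).
Hypotheses (ubX : unconditional_basis1 e) (ubY : unconditional_basis1 f).
Hypotheses (normX : normalized e) (normY : normalized f).
Variables (T : {linear X -> Y}) (S : {linear Y -> X}).
Hypothesis TSinv : inverse_isometries T S.

Lemma coord_inverse i j : coord e (S (T (e j))) i = (j == i)%:R.
Proof. by case: TSinv => _ TK _; rewrite TK (coord_basis ubX). Qed.

(** [coord e (S y) i], the functional biorthogonal to the [T (e j)], is bounded by [|y|], so its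
    values at the [f m] determine it. *)
Lemma inverse_coord_eq0 i : (forall m, coord e (S (f m)) i = 0) ->
  forall y, coord e (S y) i = 0.
Proof.
move=> S0; apply: (functional_eq0 ubY) S0 => //.
  by move=> c x y; rewrite linearP (coordD ubX) (coordZ ubX).
exists 1 => y; have [isoS _ _] := inverse_isometries_sym TSinv.
by rewrite mul1r -isoS; apply: (coord_le_norm ubX).
Qed.

Lemma norm_basis_sign k l (s : bool) : k != l ->
  `|f k + (-1) ^+ s *: f l| = `|f k + f l|.
Proof.
move=> kl; apply: (norm_coord ubY) => m.
rewrite !(coordD ubY) (coordZ ubY) !(coord_basis ubY).
case: (eqVneq k m) => [<-|_]; first by rewrite eq_sym (negbTE kl) mulr0.
by rewrite !add0r normrM normr_sign mul1r.
Qed.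

Hypothesis elemY : isometries_elementary f.

(** The cases are whether or not the permutation of the conjugated reflection is the identity. The
    values of the dual functional at the [f m] are kept because the search for a partner index needs
    them. *)
Lemma image_basis_cases i :
  (exists k, matched e f T i k /\ forall m, m != k -> coord e (S (f m)) i = 0) \/
  (exists k l c (s : bool), [/\ k != l, c != 0,
     T (e i) = c *: (f k + (-1) ^+ s *: f l)
   & forall m, coord e (S (f m)) i =
               (2 * c)^-1 * ((k == m)%:R + (-1) ^+ s * (l == m)%:R)]).
Proof.
have [isoT TK SK] := TSinv; have [isoS _ _] := inverse_isometries_sym TSinv.
pose phi m := coord e (S (f m)) i; pose g := coord f (T (e i)).
pose U y := T (reflection e i (S y)).
have Ulin : linear U.
  by move=> c x y; rewrite /U linearP (reflection_linear ubX) linearP.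
pose U' : {linear Y -> Y} := HB.pack U (GRing.isLinear.Build R Y Y *:%R U Ulin).
have isoU : surjective_isometry U'.
  split=> [y|]; first by rewrite /= /U isoT (norm_reflection ubX) isoS.
  apply/seteqP; split=> // y _; exists (U y) => //=.
  by rewrite /U TK (reflectionK ubX) SK.
have [a [sigma [sigma_bij Uf]]] := elemY isoU.
have a1 m : `|a m| = 1 by have := isoU.1 (f m); rewrite Uf normrZ !normY mulr1.
(* The defect [id - U] of the conjugated reflection has rank one, with range
   spanned by [T (e i)]. *)
have sub_reflection m : f m - a m *: f (sigma m) = (2 * phi m) *: T (e i).
  by rewrite -Uf /= /U /reflection linearB linearZ /= SK opprB addrC subrK.
(* Entry [(m, p)] of the rank-one identity; the rest of the argument reads off suitable entries. *)
have gE m p : (m == p)%:R - a m * (sigma m == p)%:R = 2 * phi m * g p.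
  have /(congr1 (fun y => coord f y p)) := sub_reflection m.
  by rewrite (coordB ubY) !(coordZ ubY) !(coord_basis ubY).
have [[k skk]|/forallNP sid] := pselect (exists k, sigma k != k).
  right; pose l := sigma k; have kl : k != l by rewrite eq_sym.
  have gk := gE k k; rewrite eqxx (negbTE skk) mulr0 subr0 mulr1n in gk.
  have gl := gE k l; rewrite (negbTE kl) sub0r eqxx mulr1 in gl.
  have [s as_] := norm1_sign (a1 k).
  have phik0 : phi k != 0.
    by apply/eqP => p0; move: gk; rewrite p0; lra.
  have gp p : p != k -> p != l -> g p = 0.
    move=> pk pl; have := gE k p.
    rewrite ![_ == p]eq_sym (negbTE pk) (negbTE pl) mulr0 subr0 => /esym/eqP.
    by rewrite !mulf_eq0 (negbTE phik0) pnatr_eq0 /= => /eqP.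
  have c0 : g k != 0 by apply/eqP => g0; move: gk; rewrite g0; lra.
  have glE : g l = (-1) ^+ (~~ s) * g k.
    apply: (@mulfI _ (2 * phi k)); first by rewrite mulf_neq0.
    by rewrite -gl mulrCA -gk as_ signrN mulr1.
  exists k, l, (g k), (~~ s); split=> //.
    apply: (coord_inj ubY) => p.
    rewrite (coordZ ubY) (coordD ubY) (coordZ ubY) !(coord_basis ubY) -/g.
    have [->|pk] := eqVneq p k.
      by rewrite eq_sym (negbTE kl) mulr0 addr0 mulr1.
    have [->|pl] := eqVneq p l.
      by rewrite add0r mulr1 glE mulrC.
    by rewrite gp // mulr0 addr0 mulr0.
  move=> m; apply: (@mulfI _ (2 * g k)); first by rewrite mulf_neq0.
  rewrite mulrA divff ?mulf_neq0 // mul1r -/(phi m).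
  have [<-|km] := eqVneq k m.
    by rewrite eq_sym (negbTE kl) mulr0 addr0 mulr1n [RHS]gk; ring.
  have [<-|lm] := eqVneq l m.
    have := gE l l; rewrite eqxx.
    (* [l] is already the image of [k], so injectivity forbids that [sigma] fix it. *)
    have /negbTE -> : sigma l != l.
      by apply: contra_neq skk => /(bij_inj sigma_bij).
    rewrite mulr0 subr0 glE; case: (s) => /=; rewrite ?expr0 ?expr1; lra.
  (* Since [g m = 0], entry [(m, m)] forces [sigma m = m]; entry [(m, k)] then gives [phi m = 0]. *)
  have := gE m m; rewrite eqxx gp 1?eq_sym // mulr0.
  have [sm|] := eqVneq (sigma m) m; last by rewrite mulr0 subr0 => _ /eqP; rewrite oner_eq0.
  move=> _; have := gE m k; rewrite sm eq_sym (negbTE km) mulr0 subrr.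
  by rewrite mulr0 addr0 mulrAC => <-.
left; have {}sid m : sigma m = m by have /negP := sid m; rewrite negbK => /eqP.
(* Otherwise the dual functional would vanish identically, yet it is 1 at [T (e i)]. *)
have [k phik0] : exists k, phi k != 0.
  apply/not_existsP => phi0.
  have := coord_inverse i i; rewrite inverse_coord_eq0 ?eqxx.
    by move/eqP; rewrite eq_sym oner_eq0.
  by move=> m; have /negP := phi0 m; rewrite negbK => /eqP.
have gp p : p != k -> g p = 0.
  move=> pk; have := gE k p.
  rewrite sid eq_sym (negbTE pk) mulr0 subr0 => /esym/eqP.
  by rewrite !mulf_eq0 (negbTE phik0) pnatr_eq0 /= => /eqP.
have Ti : T (e i) = g k *: f k.
  apply: (coord_inj ubY) => p; rewrite (coordZ ubY) (coord_basis ubY) -/g.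
  have [->|pk] := eqVneq p k; first by rewrite mulr1.
  by rewrite mulr0 gp.
have gk1 : `|g k| = 1 by have := isoT (e i); rewrite Ti normrZ normY normX mulr1.
exists k; split; first by have [s gs] := norm1_sign gk1; exists s; rewrite Ti gs.
move=> m mk; have := gE m k; rewrite sid (negbTE mk) mulr0 subr0 => /esym/eqP.
rewrite !mulf_eq0 pnatr_eq0 /= => /orP[/eqP //|/eqP g0].
by move/eqP: gk1; rewrite g0 normr0 eq_sym oner_eq0.
Qed.

Lemma image_basis_partner i k l c (s : bool) : k != l -> c != 0 ->
  T (e i) = c *: (f k + (-1) ^+ s *: f l) ->
  (forall m, coord e (S (f m)) i =
             (2 * c)^-1 * ((k == m)%:R + (-1) ^+ s * (l == m)%:R)) ->
  exists j, paired e f T i j k l.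
Proof.
move=> kl c0 Ti phi_i; have [isoT TK SK] := TSinv.
have Slin b y z m : coord e (S (b *: y + z)) m = b * coord e (S y) m + coord e (S z) m.
  by rewrite linearP (coordD ubX) (coordZ ubX).
(* The functional dual to [T (e i)] kills [v], so some other [T (e j)] does not;
   its support must then be [{k, l}] as well. *)
pose v := - (-1) ^+ s *: f l + f k.
have ss : (-1) ^+ s * (-1) ^+ s = 1 :> R by rewrite -expr2 sqrr_sign.
have [j phi_jv] : exists j, coord e (S v) j != 0.
  apply/not_existsP => v0.
  have /(congr1 T) : S v = 0.
    by apply: (coord_eq0 ubX) => j; have /negP := v0 j; rewrite negbK => /eqP.
  rewrite SK linear0 => /(congr1 (fun y => coord f y k)).
  rewrite (coordD ubY) (coordZ ubY) !(coord_basis ubY) eqxx eq_sym (negbTE kl).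
  by rewrite mulr0 add0r (coord0 ubY) => /eqP; rewrite oner_eq0.
have phi_iv : coord e (S v) i = 0.
  rewrite Slin !phi_i !eqxx ![_ == k]eq_sym (negbTE kl) mulr0 addr0 add0r.
  by rewrite mulrCA mulNr [_ * (_ * _)]mulrA ss; ring.
have ij : i != j by apply: contra_neq phi_jv => <-.
have := coord_inverse i j; rewrite eq_sym (negbTE ij) => phi_ij.
have ci : (2 * c)^-1 != 0 by rewrite invr_neq0 ?mulf_neq0.
have phi_i_neq0 m : (k == m) || (l == m) -> coord e (S (f m)) i != 0.
  rewrite phi_i mulf_eq0 (negbTE ci) /=.
  case/orP=> /eqP <-; rewrite eqxx ?[l == k]eq_sym (negbTE kl) ?mulr0 ?addr0 ?add0r ?mulr1.
    by rewrite oner_eq0.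
  by rewrite signr_eq0.
exists j; split=> //.
(* A signed basis vector [T (e j)] would have index [k] or [l], where the dual functional of [i] is
   nonzero, against biorthogonality. *)
have [[m [[t Tj] phi_j]]|[k' [l' [c' [t [kl' c0' Tj phi_j]]]]]] := image_basis_cases j.
  have : (k == m) || (l == m).
    apply: contraR phi_jv; rewrite negb_or => /andP[km lm].
    by rewrite Slin !phi_j // mulr0 addr0.
  move/phi_i_neq0; move: phi_ij; rewrite Tj linearZ (coordZ ubX) => /eqP.
  by rewrite mulf_eq0 signr_eq0 /= => ->.
have {Tj c0' c' kl' phi_j} [c' Tj] : exists c', T (e j) = c' *: (f k + (-1) ^+ t *: f l).
  have in_kl m : m != k -> m != l -> coord e (S (f m)) i = 0.
    by rewrite phi_i ![_ == m]eq_sym => /negbTE-> /negbTE->; rewrite mulr0 addr0 mulr0.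
  (* The dual functional of [i] is nonzero exactly at [k] and [l], so this relation puts [k'] and
     [l'] both inside or both outside [{k, l}]; outside, the functional of [j] would kill [v]. *)
  have phi_ikl : coord e (S (f k')) i + (-1) ^+ t * coord e (S (f l')) i = 0.
    move/eqP: phi_ij; rewrite Tj linearZ (coordZ ubX) mulf_eq0 (negbTE c0') /=.
    by rewrite addrC Slin addrC => /eqP.
  have [k'k|k'k] := eqVneq k' k.
    rewrite k'k in Tj kl' phi_ikl; have [l'l|l'l] := eqVneq l' l.
      by exists c'; rewrite Tj l'l.
    have := phi_i_neq0 k; rewrite eqxx => /(_ isT)/eqP[].
    by rewrite -phi_ikl (in_kl l') ?mulr0 ?addr0 // eq_sym.
  have [k'l|k'l] := eqVneq k' l.
    rewrite k'l in Tj kl' phi_ikl; have [l'k|l'k] := eqVneq l' k.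
      exists ((-1) ^+ t * c'); rewrite Tj l'k !scalerDr !scalerA mulrAC -expr2.
      by rewrite sqrr_sign mul1r addrC mulrC.
    have := phi_i_neq0 l; rewrite eqxx orbT => /(_ isT)/eqP[].
    by rewrite -phi_ikl (in_kl l') ?mulr0 ?addr0 // eq_sym.
  have l'0 : coord e (S (f l')) i = 0.
    move/eqP: phi_ikl; rewrite in_kl // add0r mulf_eq0 signr_eq0 /=.
    by move/eqP.
  have l'k : l' != k.
    by apply: contra_eq_neq l'0 => ->; apply: phi_i_neq0; rewrite eqxx.
  have l'l : l' != l.
    by apply: contra_eq_neq l'0 => ->; apply: phi_i_neq0; rewrite eqxx orbT.
  move: phi_jv; rewrite Slin !phi_j.
  rewrite (negbTE k'k) (negbTE k'l) (negbTE l'k) (negbTE l'l).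
  by rewrite !mulr0 addr0 mulr0 mulr0 addr0 eqxx.
have kl0 : `|f k + f l| != 0.
  apply: contra_eq_neq (isoT (e i)) => kl0.
  by rewrite Ti normrZ norm_basis_sign // kl0 mulr0 normX eq_sym oner_neq0.
have cc' : `|c'| = `|c|.
  apply: (mulIf kl0); rewrite -{1}(norm_basis_sign t kl) -(norm_basis_sign s kl).
  by rewrite -!normrZ -Tj -Ti !isoT !normX.
have c0' : c' != 0 by rewrite -normr_eq0 cc' normr_eq0.
(* Biorthogonality of [T (e j)] to the functional of [i] forces opposite relative signs. *)
have ts : (-1) ^+ t = - (-1) ^+ s :> R.
  move/eqP: phi_ij; rewrite Tj linearZ (coordZ ubX) mulf_eq0 (negbTE c0') /=.
  rewrite addrC Slin !phi_i !eqxx [l == k]eq_sym (negbTE kl) mulr0 addr0 add0r mulr1.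
  rewrite mulrCA -mulrDr mulf_eq0 (negbTE ci) /= addrC => /eqP st.
  apply: (@mulIf _ ((-1) ^+ s)); first by rewrite signr_eq0.
  by rewrite mulNr ss; apply/eqP; rewrite -subr_eq0 opprK addrC; apply/eqP.
have [u cu] : exists u : bool, c' = (-1) ^+ u * c.
  have /eqP := cc'; rewrite eqr_norm2 => /orP[/eqP->|/eqP->].
    by exists false; rewrite mul1r.
  by exists true; rewrite mulN1r.
by exists c, s, u; split=> //; rewrite Tj ts cu scaleNr.
Qed.

Lemma covered_of_elementary : covered e f T.
Proof.
have covX i : (exists k, matched e f T i k /\
      forall m, m != k -> coord e (S (f m)) i = 0) \/
    (exists j k l, paired e f T i j k l /\
      forall m, m != k -> m != l -> coord e (S (f m)) i = 0).
  have [|[k [l [c [s [kl c0 Ti phi_i]]]]]] := image_basis_cases i; first by left.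
  have [j pij] := image_basis_partner kl c0 Ti phi_i.
  right; exists j, k, l; split=> // m; rewrite phi_i ![m == _]eq_sym.
  by move=> /negbTE-> /negbTE->; rewrite mulr0 addr0 mulr0.
split=> [i|k].
  have [[k [Tik _]]|[j [k [l [pij _]]]]] := covX i; first by left; exists k.
  by right; exists j, k, l.
(* Otherwise [S (f k) = 0]. For such an [i], the vanishing recorded in [covX] places [k] in the
   support of [T (e i)]. *)
have [i phi_i] : exists i, coord e (S (f k)) i != 0.
  apply/not_existsP => S0; have [_ _ SK] := TSinv.
  have /(congr1 T) : S (f k) = 0.
    by apply: (coord_eq0 ubX) => i; have /negP := S0 i; rewrite negbK => /eqP.
  rewrite SK linear0 => /(congr1 Num.norm) /eqP.
  by rewrite normY normr0 oner_eq0.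
have [[k' [Ti phi0]]|[j [k' [l [pij phi0]]]]] := covX i.
  left; exists i; have [->//|kk'] := eqVneq k k'.
  by rewrite phi0 ?eqxx in phi_i.
right; have [->|kk'] := eqVneq k k'; first by exists i, j, l.
have [->|kl] := eqVneq k l; first by exists i, j, k'; apply: pairedCr.
by rewrite phi0 ?eqxx in phi_i.
Qed.

End ElementaryTarget.

(** * Unordered pairs and supports of images *)

Lemma set1_neq_set2 (I : Type) (i j k : I) : j <> k -> [set i] <> [set j; k].
Proof.
move=> jk E; apply: jk.
have -> : j = i by have : [set i] j by rewrite E; left.
by have : [set i] k by rewrite E; right.
Qed.

Lemma set2_eq (I : Type) (i j i' j' : I) : i <> j ->
  [set i; j] = [set i'; j'] -> (i = i' /\ j = j') \/ (i = j' /\ j = i').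
Proof.
move=> ij Eij; have : [set i'; j'] i by rewrite -Eij; left.
have : [set i'; j'] j by rewrite -Eij; right.
by move=> [jE|jE] [iE|iE]; rewrite /= in iE jE; rewrite iE jE in ij *; auto.
Qed.

Section Supports.
Context (R : realType) (d : option nat) (X Y : completeNormedModType R).
Variables (e : idx d -> X) (f : idx d -> Y).
Hypothesis ubY : unconditional_basis1 f.
Variable T : X -> Y.

(** A singleton for a matched index and a two-element set for a paired one, so the support tells the
    two shapes apart. *)
Definition support_image (i : idx d) : set (idx d) :=
  [set m | coord f (T (e i)) m != 0].

Lemma support_matched i k : matched e f T i k -> support_image i = [set k].
Proof.
case=> s Ti; apply/seteqP; split=> m; rewrite /support_image /= Ti;
  rewrite (coordZ ubY) (coord_basis ubY) mulf_eq0 signr_eq0 /=.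
  by case: (eqVneq k m) => // _; rewrite eqxx.
by move=> ->; rewrite eqxx oner_eq0.
Qed.

Lemma support_two_terms i k l (c : R) (s : bool) : k != l -> c != 0 ->
  T (e i) = c *: (f k + (-1) ^+ s *: f l) -> support_image i = [set k; l].
Proof.
move=> kl c0 Ti.
apply/seteqP; split=> m; rewrite /support_image /= Ti (coordZ ubY) (coordD ubY);
  rewrite (coordZ ubY) !(coord_basis ubY) mulf_eq0 (negbTE c0) /=.
  case: (eqVneq k m) => [->|_]; first by left.
  by case: (eqVneq l m) => [->|_]; [right|rewrite mulr0 addr0 eqxx].
move=> [->|->]; rewrite eqxx.
  by rewrite [l == k]eq_sym (negbTE kl) mulr0 addr0 oner_eq0.
by rewrite (negbTE kl) add0r mulr1 signr_eq0.
Qed.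

Lemma support_paired i j k l :
  paired e f T i j k l -> support_image i = [set k; l].
Proof.
by move=> [_ kl [c [s [t [c0 Ti _]]]]]; apply: support_two_terms c0 Ti.
Qed.

Lemma support_paired2 i j k l i0 :
  paired e f T i j k l -> [set i; j] i0 -> support_image i0 = [set k; l].
Proof.
move=> p [->|->]; first exact: support_paired p.
by apply: (@support_paired j i); apply: pairedCl.
Qed.

(** A choice-free form of [tau]; on a pair, the support of either image is already the whole
    value. *)
Definition image_pair (p : set (idx d)) : set (idx d) :=
  \bigcup_(i in p) support_image i.

Lemma image_pairE i j k l :
  paired e f T i j k l -> image_pair [set i; j] = [set k; l].
Proof.
move=> p; apply/seteqP; split=> m.
  by case=> i0 /(support_paired2 p) ->.
by move=> klm; exists i; [left | rewrite (support_paired p)].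
Qed.

Definition matched_idx : set (idx d) := [set i | exists k, matched e f T i k].

Definition pairs : set (set (idx d)) :=
  [set p | exists i j k l, paired e f T i j k l /\ p = [set i; j]].

End Supports.

(** * Partition into pairs, and interchangeability *)

Section Decomposition.
Context (R : realType) (d : option nat) (X Y : completeNormedModType R).
Variables (e : idx d -> X) (f : idx d -> Y).
Hypotheses (ubX : unconditional_basis1 e) (ubY : unconditional_basis1 f).
Variables (T : {linear X -> Y}) (S : {linear Y -> X}).
Hypothesis TSinv : inverse_isometries T S.

Lemma image_pair_fun p : pairs e f T p -> pairs f e S (image_pair e f T p).
Proof.
case=> i [j [k [l [pij ->]]]]; rewrite (image_pairE ubY pij).
by exists k, l, i, j; split=> //; apply: paired_sym pij.
Qed.

Lemma image_pairK p :
  pairs e f T p -> image_pair f e S (image_pair e f T p) = p.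
Proof.
case=> i [j [k [l [pij ->]]]].
by rewrite (image_pairE ubY pij) (image_pairE ubX (paired_sym TSinv pij)).
Qed.

Lemma matched_not_paired p i : pairs e f T p -> p i -> ~ matched_idx e f T i.
Proof.
case=> i' [j' [k [l [pij ->]]]] /(support_paired2 ubY pij) Ei [m].
move/(support_matched ubY); rewrite Ei => /esym; apply: set1_neq_set2.
by case: pij => _ /eqP.
Qed.

Hypothesis cov : covered e f T.

Lemma pairs_partition : pair_partition (~` matched_idx e f T) (pairs e f T).
Proof.
split; last first.
  by move=> p [i [j [k [l [[ij _ _] ->]]]]]; exists i, j; split=> //; apply/eqP.
split.
- apply/seteqP; split=> i.
    by case=> p Pp pi; apply: matched_not_paired Pp pi.
  move=> nmi; have [//|[j [k [l pij]]]] := cov.1 i.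
  by exists [set i; j]; [exists i, j, k, l | left].
(* Pairs sharing [i] have the same image, the support of [T (e i)], and a pair is recovered from its
   image through [S]. *)
- move=> p q Pp Pq [i [pi qi]]; rewrite -(image_pairK Pp) -(image_pairK Pq).
  congr (image_pair _ _ _ _).
  case: Pp pi => i1 [j1 [k1 [l1 [p1 ->]]]] pi.
  case: Pq qi => i2 [j2 [k2 [l2 [p2 ->]]]] qi.
  rewrite (image_pairE ubY p1) (image_pairE ubY p2).
  by rewrite -(support_paired2 ubY p1 pi) -(support_paired2 ubY p2 qi).
by move=> p [i [j [k [l [_ ->]]]]]; exists i; left.
Qed.

(** By coverage, [j] lies in the support of [S (f m)] only if [m] lies in that of [T (e j)], which
    is [{k, l}]. *)
Lemma coord_inverse_eq0 i j k l m : paired e f T i j k l ->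
  m != k -> m != l -> coord e (S (f m)) j = 0.
Proof.
move=> pij mk ml; apply/eqP; apply: contraT => mj.
have {}mj : support_image f e S m j by [].
have Ej := support_paired ubY (pairedCl pij).
have [[i' mi']|[i' [j' [l' p']]]] := cov.2 m.
  rewrite (support_matched ubX (matched_sym TSinv mi')) in mj.
  rewrite mj (support_matched ubY mi') in Ej.
  by case: pij => _ /eqP kl _; case: (set1_neq_set2 kl Ej).
rewrite (support_paired ubX (paired_sym TSinv p')) in mj.
have : [set k; l] m by rewrite -Ej (support_paired2 ubY p' mj); left.
by case=> mE; rewrite mE eqxx in mk ml.
Qed.

Hypotheses (normX : normalized e) (normY : normalized f).

Lemma paired_interchangeable i j k l :
  paired e f T i j k l -> interchangeable f k l.
Proof.
move=> pij x z a b ax bz; rewrite -(coord_unique ubY ax) -(coord_unique ubY bz).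
move=> akl alk aE {a b ax bz}.
have [isoT TK SK] := TSinv; have [isoS _ _] := inverse_isometries_sym TSinv.
have [ij kl [c [s [t [c0 Ti Tj]]]]] := pij.
have ss : (-1) ^+ s * (-1) ^+ s = 1 :> R by rewrite -expr2 sqrr_sign.
have norm_sign b : `|b| = `|(-1) ^+ s * b| by rewrite normrM normr_sign mul1r.
pose phi y := coord e (S y) j; pose r := phi (f k).
have philin b y y' : phi (b *: y + y') = b * phi y + phi y'.
  by rewrite /phi linearP (coordD ubX) (coordZ ubX).
have phiTi : phi (T (e i)) = 0 by rewrite /phi TK (coord_basis ubX) (negbTE ij).
have phiTj : phi (T (e j)) = 1 by rewrite /phi TK (coord_basis ubX) eqxx.
have phil : phi (f l) = - (-1) ^+ s * r.
  have phiZ b y : phi (b *: y) = b * phi y by rewrite /phi linearZ (coordZ ubX).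
  move/eqP: phiTi; rewrite Ti phiZ mulf_eq0 (negbTE c0) /= addrC philin => /eqP.
  move/(congr1 (fun u => (-1) ^+ s * u)); rewrite mulrDr mulrA ss mul1r mulr0 -/r.
  by move/eqP; rewrite addr_eq0 mulNr => /eqP.
(* The dual functional of [j] vanishes at every other [f m], so by boundedness it depends on two
   coordinates only. *)
have phiE y : phi y = r * (coord f y k - (-1) ^+ s * coord f y l).
  apply/eqP; rewrite -subr_eq0; apply/eqP; move: y.
  apply: (functional_eq0 ubY) => [b y y'||m].
  - by rewrite philin !(coordD ubY) !(coordZ ubY); ring.
  - exists (1 + `|r| * 2) => y; apply: (le_trans (ler_normB _ _)).
    rewrite mulrDl mul1r; apply: lerD; first by rewrite -isoS; apply: coord_le_norm.
    rewrite normrM -mulrA; apply: ler_wpM2l => //.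
    apply: (le_trans (ler_normB _ _)); rewrite normrM normr_sign mul1r mulrDl mul1r.
    by apply: lerD; apply: coord_le_norm.
  rewrite !(coord_basis ubY); have [->|mk] := eqVneq m k.
    by rewrite (negbTE kl) mulr0 subr0 mulr1 subrr.
  have [->|ml] := eqVneq m l; first by rewrite phil sub0r mulr1; ring.
  by rewrite /phi (coord_inverse_eq0 pij mk ml) mulr0 subr0 mulr0 subr0.
pose a := (-1) ^+ t * c; rewrite -/a in Tj.
(* The value 1 at [T (e j)] fixes the scale of the functional. *)
have ra : 2 * r * a = 1.
  rewrite -[RHS]phiTj phiE Tj !(coordZ ubY) !(coordB ubY) !(coordZ ubY) !(coord_basis ubY).
  rewrite !eqxx [l == k]eq_sym (negbTE kl) mulr0 subr0 mulr1 sub0r mulr1n.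
  transitivity (r * (a + (-1) ^+ s * (-1) ^+ s * a)); first by rewrite ss; ring.
  by ring.
(* Conjugating the reflection along [e j] yields an isometry of [Y] exchanging
   the coordinates [k] and [l] up to sign. *)
have UE m : coord f (T (reflection e j (S x))) m =
    coord f x m - (coord f x k - (-1) ^+ s * coord f x l) *
      ((k == m)%:R - (-1) ^+ s * (l == m)%:R).
  rewrite /reflection linearB linearZ SK (coordB ubY) (coordZ ubY) Tj (coordZ ubY).
  rewrite (coordB ubY) (coordZ ubY) !(coord_basis ubY) -/(phi x) phiE; congr (_ - _).
  set u := coord f x k - _; set v := _%:R - _.
  transitivity (2 * r * a * (u * v)); last by rewrite ra mul1r.
  by ring.
rewrite -(isoS x) -(norm_reflection ubX j) -isoT; apply: (norm_coord ubY) => m.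
rewrite UE; have [->|mk] := eqVneq m k.
  rewrite [l == k]eq_sym (negbTE kl) -alk [RHS]norm_sign.
  by congr `|_|; rewrite mulr0 subr0 mulr1; ring.
have [->|ml] := eqVneq m l.
  rewrite -akl [RHS]norm_sign.
  congr `|_|; rewrite mulr1n mulr1 sub0r; set u := coord f x k; set v := coord f x l.
  transitivity (v - (-1) ^+ s * (-1) ^+ s * v + (-1) ^+ s * u); first by ring.
  by rewrite ss; ring.
rewrite mulr0 subr0 mulr0 subr0.
by apply: aE; apply/eqP.
Qed.

End Decomposition.

(** * Construction of the decomposition *)

Section DecompositionExists.
Context (R : realType) (d : option nat) (X Y : completeNormedModType R).
Variables (e : idx d -> X) (f : idx d -> Y).
Hypotheses (ubX : unconditional_basis1 e) (ubY : unconditional_basis1 f).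
Variables (T : {linear X -> Y}) (S : {linear Y -> X}).
Hypothesis TSinv : inverse_isometries T S.
Hypotheses (normX : normalized e) (cov : covered e f T).

(** Off [matched_idx] the value is the default [i], which no clause of the decomposition reads. *)
Definition match_idx (i : idx d) : idx d := xget i [set k | matched e f T i k].

Lemma match_idxP i : matched_idx e f T i -> matched e f T i (match_idx i).
Proof. by rewrite /match_idx => -[k Tik]; case: xgetP => [m -> //|/(_ k)]. Qed.

Lemma matched_fun i k m : matched e f T i k -> matched e f T i m -> k = m.
Proof.
move=> /(support_matched ubY) Ek /(support_matched ubY); rewrite Ek => E.
by have : [set k] k by []; rewrite E.
Qed.

(** Lets the partition on the side of [Y] come from [pairs_partition] applied to [S]. *)
Lemma match_idx_image :
  match_idx @` matched_idx e f T = matched_idx f e S.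
Proof.
apply/seteqP; split=> [_ [i Ai <-]|k [i /(matched_sym (inverse_isometries_sym TSinv)) Tik]].
  by exists i; apply/(matched_sym TSinv)/match_idxP.
have Ai : matched_idx e f T i by exists k.
by exists i => //; apply: matched_fun Tik; apply: match_idxP.
Qed.

Lemma paired_formulas i j k l : paired e f T i j k l ->
  exists k l, [/\ k <> l, image_pair e f T [set i; j] = [set k; l] &
    exists delta eps : bool,
      T (e i) = ((-1) ^+ delta / `|f k + f l|) *: (f k + (-1) ^+ eps *: f l) /\
      T (e j) = ((-1) ^+ delta / `|f k + f l|) *: (f k - (-1) ^+ eps *: f l)].
Proof.
have [isoT _ _] := TSinv.
(* As [T (e i)] has norm one, [c] times the norm of [f k1 + f l1] has modulus one and is a sign. *)
have aux k1 l1 c (s : bool) : k1 != l1 -> T (e i) = c *: (f k1 + (-1) ^+ s *: f l1) ->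
    exists delta : bool, c = (-1) ^+ delta / `|f k1 + f l1|.
  move=> kl Ti; have := isoT (e i); rewrite Ti normX normrZ (norm_basis_sign ubY) //.
  rewrite -[X in _ * X]normr_id -normrM => /norm1_sign[delta cE]; exists delta.
  rewrite -cE mulfK //; apply/eqP => kl0; move/eqP: cE.
  by rewrite kl0 mulr0 eq_sym signr_eq0.
(* A negative relative sign [t] is absorbed by exchanging [k] and [l]. *)
move=> p; have [_ kl [c [s [t [c0 Ti Tj]]]]] := p; case: t Tj => Tj.
  have {}Ti : T (e i) = ((-1) ^+ s * c) *: (f l + (-1) ^+ s *: f k).
    by rewrite Ti !scalerDr !scalerA mulrAC -expr2 sqrr_sign mul1r addrC mulrC.
  have {}Tj : T (e j) = ((-1) ^+ s * c) *: (f l - (-1) ^+ s *: f k).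
    have scs : (-1) ^+ s * c * (-1) ^+ s = c by rewrite mulrAC -expr2 sqrr_sign mul1r.
    rewrite Tj !scalerBr !scalerA scs expr1 mulN1r mulNr !scaleNr opprK addrC.
    by rewrite [c * _]mulrC.
  have lk : l != k by rewrite eq_sym.
  have [delta cE] := aux l k _ s lk Ti.
  exists l, k; split; [exact/eqP | | by exists delta, s; rewrite -cE].
  by rewrite (image_pairE ubY p) setUC.
have [delta cE] := aux k l _ s kl Ti.
exists k, l; split; [exact/eqP | exact: image_pairE p |].
by exists delta, s; rewrite -cE Tj mul1r.
Qed.

Lemma decomposition_exists :
  decomposition e f T (matched_idx e f T) match_idx
    (pairs e f T) (pairs f e S) (image_pair e f T).
Proof.
have STinv := inverse_isometries_sym TSinv; have covS := covered_sym TSinv cov.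
split.
- split; last by move=> i /match_idxP[s Ti]; exists s.
  (* The support of [S (f (match_idx i))] is [{i}], so [match_idx i] determines [i]. *)
  move=> i j /set_mem/match_idxP/(matched_sym TSinv)/(support_matched ubX) Ei.
  move=> /set_mem/match_idxP/(matched_sym TSinv)/(support_matched ubX) Ej ij.
  by have : [set i] i by []; rewrite -Ei ij Ej.
- exact: pairs_partition TSinv cov.
- by rewrite match_idx_image; apply: pairs_partition STinv covS.
- split=> [p|p q /set_mem Pp /set_mem Pq pq|q Pq].
  + exact: (image_pair_fun ubY TSinv).
  + by rewrite -(image_pairK ubX ubY TSinv Pp) pq (image_pairK ubX ubY TSinv).
  exists (image_pair f e S q); first exact: (image_pair_fun ubX STinv).
  exact: (image_pairK ubY ubX STinv).
move=> i j ij [i' [j' [k [l [pij Eij]]]]].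
have [[-> ->]|[-> ->]] := set2_eq ij Eij; first exact: paired_formulas pij.
exact: paired_formulas (pairedCl pij).
Qed.

End DecompositionExists.

(** * Independence of the isometry *)

Section Uniqueness.
Context (R : realType) (d : option nat) (X Y : completeNormedModType R).
Variables (e : idx d -> X) (f : idx d -> Y).
Hypotheses (ubX : unconditional_basis1 e) (ubY : unconditional_basis1 f).
Hypotheses (normX : normalized e) (normY : normalized f).

(** Indices outside [A] have images with two-element support, so [T] alone determines [A], and
    independence of [T] becomes a question about matched indices. *)
Lemma decomposition_domain (T : {linear X -> Y}) A sigma PX PY tau :
  surjective_isometry T -> decomposition e f T A sigma PX PY tau ->
  A = matched_idx e f T.
Proof.
move=> [isoT _] [[_ TA] [[coverX _ _] pairX] _ _ Tpair].
apply/seteqP; split=> [i /TA[s Ti]|i [m Tim]]; first by exists (sigma i), s.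
apply: contrapT => nAi.
have unmatched c k l (s : bool) : k <> l -> T (e i) = c *: (f k + (-1) ^+ s *: f l) -> False.
  move=> /eqP kl Ti; have [c0|c0] := eqVneq c 0.
    by have /eqP := isoT (e i); rewrite Ti c0 scale0r normr0 normX eq_sym oner_eq0.
  have := support_matched ubY Tim; rewrite (support_two_terms ubY kl c0 Ti).
  by move/esym; apply: set1_neq_set2; apply/eqP.
have : cover PX id i by rewrite coverX.
case=> p PXp /= pi; have [i0 [j0 [ij0 pE]]] := pairX _ PXp; subst p.
have [k [l [kl _ [delta [eps [Ti Tj]]]]]] := Tpair _ _ ij0 PXp.
case: pi => /= iE; rewrite -iE in Ti Tj; first exact: unmatched kl Ti.
by apply: (unmatched _ _ _ (~~ eps) kl); rewrite signrN scaleNr; apply: Tj.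
Qed.

Lemma decomposition_image (T : {linear X -> Y}) A sigma PX PY tau :
  surjective_isometry T -> decomposition e f T A sigma PX PY tau ->
  sigma @` A = [set k | exists i, matched e f T i k].
Proof.
move=> isoT dec; have AE := decomposition_domain isoT dec.
have [[_ TA] _ _ _ _] := dec.
apply/seteqP; split=> [_ [i /TA[s Ti] <-]|k [i Tik]]; first by exists i, s.
have Ai : A i by rewrite AE; exists k.
exists i => //; apply: (matched_fun ubY) Tik.
by have [s Ti] := TA _ Ai; exists s.
Qed.

Lemma matched_transfer (T T' : {linear X -> Y}) i k :
  isometries_elementary f -> surjective_isometry T -> surjective_isometry T' ->
  matched e f T i k -> exists k', matched e f T' i k'.
Proof.
move=> elemY /inverse_isometriesP[S TS] isoT' [s Ti].
have [isoT TK SK] := TS; have [isoS _ _] := inverse_isometries_sym TS.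
pose W : {linear Y -> Y} := T' \o S.
have [|a [sigma [_ Wf]]] := elemY W.
  split=> [y|]; first by rewrite /= isoT'.1 isoS.
  apply/seteqP; split=> // y _; have [x _ <-] : range T' y by rewrite isoT'.2.
  by exists (T x) => //=; rewrite TK.
have a1 : `|a k| = 1.
  by rewrite -[LHS]mulr1 -(normY (sigma k)) -normrZ -Wf /= isoT'.1 isoS normY.
have [t at_] := norm1_sign a1.
exists (sigma k), (s (+) t).
have Wfk : T' (S (f k)) = a k *: f (sigma k) := Wf k.
by rewrite -[e i]TK Ti !linearZ Wfk at_ /= scalerA signr_addb.
Qed.

End Uniqueness.

Theorem theorem4 (R : realType) (d : option nat)
  (X Y : completeNormedModType R) (e : idx d -> X) (f : idx d -> Y)
  (sepX : separable X) (sepY : separable Y)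
  (basisX : unconditional_basis1 e) (basisY : unconditional_basis1 f)
  (normX : normalized e) (normY : normalized f)
  (elem : isometries_elementary e \/ isometries_elementary f)
  (T : {linear X -> Y}) (isoT : surjective_isometry T) :
  exists (A : set (idx d)) (sigma : idx d -> idx d)
         (PX PY : set (set (idx d))) (tau : set (idx d) -> set (idx d)),
    [/\ decomposition e f T A sigma PX PY tau,
        (forall i j, i <> j -> PX [set i; j] -> interchangeable e i j) /\
        (forall k l, k <> l -> PY [set k; l] -> interchangeable f k l),
        (isometries_elementary f ->
          forall (T' : {linear X -> Y}) A' sigma' PX' PY' tau',
            surjective_isometry T' ->
            decomposition e f T' A' sigma' PX' PY' tau' ->
            A' = A)
      & (isometries_elementary e ->
          forall (T' : {linear X -> Y}) A' sigma' PX' PY' tau',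
            surjective_isometry T' ->
            decomposition e f T' A' sigma' PX' PY' tau' ->
            sigma' @` A' = sigma @` A)].
Proof.
have [S TS] := inverse_isometriesP isoT.
have STinv := inverse_isometries_sym TS.
have cov : covered e f T.
  case: elem => [elemX|elemY]; last first.
    exact: (covered_of_elementary basisX basisY normX normY TS elemY).
  (* When the isometries of [X] are the elementary ones, [S] has the elementary target. *)
  apply: (covered_sym STinv).
  exact: (covered_of_elementary basisY basisX normY normX STinv elemX).
have dec := decomposition_exists basisX basisY TS normX cov.
exists (matched_idx e f T), (match_idx e f T), (pairs e f T), (pairs f e S),
  (image_pair e f T); split=> //.
(* Interchangeability was shown in the target space, so pairs of [X] are treated through [S] and
   pairs of [Y] through [T]. *)
- split=> [i j ij|k l kl] [i' [j' [k' [l' [p E]]]]].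
    have q := paired_sym TS p; have covS := covered_sym TS cov.
    have int := paired_interchangeable basisY basisX STinv covS normY normX.
    by have [[-> ->]|[-> ->]] := set2_eq ij E; [exact: (int _ _ _ _ q)
      | exact: (int _ _ _ _ (pairedCr q))].
  have int := paired_interchangeable basisX basisY TS cov normX normY.
  have q := paired_sym STinv p.
  by have [[-> ->]|[-> ->]] := set2_eq kl E; [exact: (int _ _ _ _ q)
      | exact: (int _ _ _ _ (pairedCr q))].
- move=> elemY T' A' sigma' PX' PY' tau' isoT' /(decomposition_domain basisY normX isoT') ->.
  by apply/seteqP; split=> i [k]; apply: (matched_transfer normY elemY).
move=> elemX T' A' sigma' PX' PY' tau' isoT' dec'.
rewrite (decomposition_image basisY normX isoT' dec').
rewrite (decomposition_image basisY normX isoT dec).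
have [S' TS'] := inverse_isometriesP isoT'.
have sur U V : @inverse_isometries R X Y U V -> surjective_isometry V.
  move=> /inverse_isometries_sym[isoV _ VK]; split=> //.
  by apply/seteqP; split=> // x _; exists (U x).
(* Indices hit in [Y] are the matched indices of the inverse isometries, whose target [X] is now
   elementary. *)
have transfer U V U' V' i k : @inverse_isometries R X Y U V ->
    @inverse_isometries R X Y U' V' -> matched e f U i k ->
    exists i', matched e f U' i' k.
  move=> UV UV' /(matched_sym UV) m.
  have [i' m'] := matched_transfer normX elemX (sur _ _ UV) (sur _ _ UV') m.
  by exists i'; apply: matched_sym (inverse_isometries_sym UV') _ _ m'.
by apply/seteqP; split=> k [i]; [exact: transfer TS' TS | exact: transfer TS TS'].
Qed.
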